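(* Let $M = \begin{bmatrix} \alpha & \beta & 0 \\ \gamma & \delta & 0 \\ e & f & 0 \end{bmatrix} \in M_3^0(\mathbb{Z}/2^k\mathbb{Z})$ and suppose $A \equiv B \equiv C \equiv 0 \pmod{2^k}$. (1) If $\gamma$ or $\delta$ is odd, then $\mu(M, k) = 0$. (2) If $\gamma$ and $\delta$ are both even but one of $\alpha, \beta, e, f$ is odd, then $\mu(M, k) = \frac{1}{6 \cdot 64^{k-1}}$.
   Context: $M_3^0(\mathbb{Z}/2^k\mathbb{Z})$ is the set of $3\times 3$ matrices over $\mathbb{Z}/2^k\mathbb{Z}$ with third column zero. For such a matrix $\begin{bmatrix} \alpha & \beta & 0 \\ \gamma & \delta & 0 \\ e & f & 0 \end{bmatrix}$, $A = \gamma f - \delta e$, $B = \alpha f - \beta e$, $C = \alpha\delta - \beta\gamma$. $\mathrm{ord}_2(r)$ is the exponent of the highest power of 2 dividing $r$ (with $\mathrm{ord}_2(0) \ge k$ declared true in $\mathbb{Z}/2^k\mathbb{Z}$). For $M_0 \in M_3^0(\mathbb{Z}/2^r\mathbb{Z})$, $\eta(M_0, r, k) = \#\{ N \in M_3^0(\mathbb{Z}/2^k\mathbb{Z}) : N \equiv M_0 \pmod{2^r},\ \mathrm{ord}_2(A) > \mathrm{ord}_2(B),\ \mathrm{ord}_2(C) > \mathrm{ord}_2(B)\}$ (with $A,B,C$ computed from $N$) and $\mu(M_0, r) = \lim_{k \to \infty} \eta(M_0, r, k)/(8192 \cdot 64^{k-3})$, where $8192$ is the order of the group $I_3$. *)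

(* Defs.v *)
From HB Require Import structures.
From mathcomp Require Import all_boot all_order all_algebra.
From mathcomp Require Import all_classical all_reals all_analysis.

Set Implicit Arguments.
Unset Strict Implicit.
Unset Printing Implicit Defensive.

Import Order.TTheory GRing.Theory Num.Theory.
Import numFieldNormedType.Exports.
Local Open Scope ring_scope.

(* Z/2^kZ is 'Z_(2 ^ k), which is the right ring only for k > 0: 'Z_1 is Z/2. *)

Definition M30 (k : nat) : {set 'M['Z_(2 ^ k)]_3} :=
  [set M : 'M['Z_(2 ^ k)]_3 | [forall i, M i 2 == 0]].

Section Minors.
Variables (S : comPzRingType) (M : 'M[S]_3).

Definition entry_alpha : S := M 0 0.
Definition entry_beta  : S := M 0 1.
Definition entry_gamma : S := M 1 0.
Definition entry_delta : S := M 1 1.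
Definition entry_e     : S := M 2 0.
Definition entry_f     : S := M 2 1.

Definition minorA : S := entry_gamma * entry_f - entry_delta * entry_e.
Definition minorB : S := entry_alpha * entry_f - entry_beta * entry_e.
Definition minorC : S := entry_alpha * entry_delta - entry_beta * entry_gamma.

End Minors.

(* Parity in Z/2^kZ is read on the representative in [0, 2^k). *)
Definition zodd (k : nat) (x : 'Z_(2 ^ k)) : bool := odd (x : nat).

(* A nonzero class has order < k, so ord2 0 = k encodes "ord_2(0) >= k";
   ord2 x > ord2 0 never holds. *)
Definition ord2 (k : nat) (x : 'Z_(2 ^ k)) : nat :=
  if x == 0 then k else logn 2 (x : nat).

Definition congr_mx (r k : nat)
    (N : 'M['Z_(2 ^ k)]_3) (M0 : 'M['Z_(2 ^ r)]_3) : bool :=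
  [forall i, forall j, (N i j : nat) == (M0 i j : nat) %[mod 2 ^ r]].

(* Meaningful for k >= r and k > 0, all that matters in the limit. *)
Definition eta (r : nat) (M0 : 'M['Z_(2 ^ r)]_3) (k : nat) : nat :=
  #|[set N in M30 k | [&& congr_mx N M0,
                          (ord2 (minorB N) < ord2 (minorA N))%N &
                          (ord2 (minorB N) < ord2 (minorC N))%N]]|.

(* The exponent k - 3 is an integer. *)
Definition mu_seq (R : realType) (r : nat) (M0 : 'M['Z_(2 ^ r)]_3) (k : nat) : R :=
  (eta M0 k)%:R / (8192 * 64 ^ (k%:Z - 3)).

(* limn is a junk value on divergent sequences, so statements about mu should
   also assert that mu_seq converges. *)
Definition mu (R : realType) (r : nat) (M0 : 'M['Z_(2 ^ r)]_3) : R :=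
  limn (mu_seq R M0).

(* Main.v *)
(** With [v1, v2, v3] the rows of [N], the identity [A v1 - B v2 + C v3 = 0]
    holds. If [gamma] or [delta] is odd it writes [B] as a combination of [A]
    and [C], so no lift of [M] has [ord2 B < ord2 A] and [ord2 B < ord2 C].

    If [gamma] and [delta] are even and, say, [alpha] is odd, a lift [N] of [M]
    mod [2^r] to [Z/2^n] is determined by [alpha, beta, gamma, e, B, C], the last two
    being arbitrary multiples of [2^r]; moreover [alpha A = gamma B - e C], so
    that [ord2 B < ord2 C] already implies [ord2 B < ord2 A]. With [m = n - r]
    there are [(4^m - 1) / 3] pairs with [r <= ord2 B < ord2 C], hence
    [(64^m - 16^m) / 3] lifts, which gives the limit. Exchanging the columns,
    or the first and third rows, reduces the other cases to this one. *)

Require Import Defs.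
From HB Require Import structures.
From mathcomp Require Import all_boot all_order all_algebra.
From mathcomp Require Import all_classical all_reals all_analysis.
From mathcomp Require Import perm zify ring lra.
Import Order.TTheory GRing.Theory Num.Theory.
Import numFieldNormedType.Exports.
Local Open Scope ring_scope.

(** * Divisibility by powers of 2 and [ord2] in Z/2^n *)

Lemma exp2_gt1 n : (0 < n)%N -> (1 < 2 ^ n)%N.
Proof. by move=> n0; rewrite -(expn0 2) ltn_exp2l. Qed.

Lemma Zexp2_lt n (x : 'Z_(2 ^ n)) : (0 < n)%N -> (x < 2 ^ n)%N.
Proof. by move=> n0; rewrite -[X in (_ < X)%N]Zp_cast ?exp2_gt1. Qed.

(** As [2 ^ i] divides [2 ^ n], passing to the representative does not affect divisibility by
    [2 ^ i]; the closure rules below are transferred from [nat] this way. *)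
Lemma dvd_Zexp2_nat n i m : (0 < n)%N -> (i <= n)%N ->
  (2 ^ i %| (m%:R : 'Z_(2 ^ n)))%N = (2 ^ i %| m)%N.
Proof.
move=> n0 lein; rewrite val_Zp_nat ?exp2_gt1// /dvdn modn_dvdm//.
exact: dvdn_exp2l.
Qed.

Lemma dvd_Zexp2D n i (x y : 'Z_(2 ^ n)) : (0 < n)%N -> (i <= n)%N ->
  (2 ^ i %| x)%N -> (2 ^ i %| y)%N -> (2 ^ i %| (x + y)%R)%N.
Proof.
move=> n0 lein dx dy; rewrite -(natr_Zp x) -(natr_Zp y) -natrD.
by rewrite dvd_Zexp2_nat// dvdn_add.
Qed.

Lemma dvd_Zexp2M n i j (x y : 'Z_(2 ^ n)) : (0 < n)%N -> (i + j <= n)%N ->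
  (2 ^ i %| x)%N -> (2 ^ j %| y)%N -> (2 ^ (i + j) %| (x * y)%R)%N.
Proof.
move=> n0 leijn dx dy; rewrite -(natr_Zp x) -(natr_Zp y) -natrM.
by rewrite dvd_Zexp2_nat// expnD dvdn_mul.
Qed.

Lemma dvd_Zexp2Ml n i (x y : 'Z_(2 ^ n)) : (0 < n)%N -> (i <= n)%N ->
  (2 ^ i %| y)%N -> (2 ^ i %| (x * y)%R)%N.
Proof. by move=> n0 lein dy; apply: (@dvd_Zexp2M n 0); rewrite ?dvd1n. Qed.

Lemma dvd_Zexp2N n i (x : 'Z_(2 ^ n)) : (0 < n)%N -> (i <= n)%N ->
  (2 ^ i %| (- x)%R)%N = (2 ^ i %| x)%N.
Proof.
move=> n0 lein; apply/idP/idP => dx; last first.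
  by rewrite -mulN1r dvd_Zexp2Ml.
by rewrite -[x]opprK -mulN1r dvd_Zexp2Ml.
Qed.

(** For [x = 0] the equivalence relies on [i <= n], because [ord2 0] is [n]. *)
Lemma leq_ord2 n i (x : 'Z_(2 ^ n)) : (0 < n)%N -> (i <= n)%N ->
  (i <= ord2 x)%N = (2 ^ i %| x)%N.
Proof.
move=> n0 lein; rewrite /ord2; case: eqVneq => [->|x0].
  by rewrite lein dvdn0.
by rewrite pfactor_dvdn// lt0n.
Qed.

Lemma ord2_leq n (x : 'Z_(2 ^ n)) : (0 < n)%N -> (ord2 x <= n)%N.
Proof.
move=> n0; rewrite /ord2; case: eqVneq => // x0.
rewrite -ltnS -(@ltn_exp2l 2)//; apply: leq_ltn_trans (_ : (x < _)%N).
  by rewrite dvdn_leq ?lt0n// pfactor_dvdnn.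
by rewrite (leq_trans (Zexp2_lt _ _ n0))// leq_exp2l.
Qed.

Lemma ord2N n (x : 'Z_(2 ^ n)) : (0 < n)%N -> ord2 (- x) = ord2 x.
Proof.
move=> n0; have le_ord2N y : (ord2 y <= ord2 (- y : 'Z_(2 ^ n)))%N.
  by rewrite leq_ord2 ?ord2_leq// dvd_Zexp2N ?ord2_leq// -leq_ord2 ?ord2_leq.
by apply/eqP; rewrite eqn_leq le_ord2N -{2}[x]opprK le_ord2N.
Qed.

Lemma zodd_unit n (x : 'Z_(2 ^ n)) : (0 < n)%N -> zodd x = (x \is a GRing.unit).
Proof.
move=> n0; rewrite -{2}(natr_Zp x) unitZpE ?exp2_gt1//.
by rewrite coprime_pexpl// coprime2n.
Qed.

(** * Reduction from Z/2^n to Z/2^r *)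

Definition red2 r n (x : 'Z_(2 ^ n)) : 'Z_(2 ^ r) := (x : nat)%:R.

(** Since [2 ^ r] divides [2 ^ n], the class mod [2 ^ r] does not depend on the representative
    chosen; compatibility with the ring operations follows. *)
Lemma red2_nat r n m : (0 < r <= n)%N -> red2 r n m%:R = m%:R.
Proof.
case/andP => r0 lern; have n0 := leq_trans r0 lern.
apply: val_inj; rewrite /= !val_Zp_nat ?exp2_gt1//.
by rewrite modn_dvdm// dvdn_exp2l.
Qed.

Lemma red2D r n x y : (0 < r <= n)%N -> red2 r n (x + y) = red2 r n x + red2 r n y.
Proof.
by move=> rn; rewrite -{1}(natr_Zp x) -{1}(natr_Zp y) -natrD red2_nat// natrD.
Qed.

Lemma red2M r n x y : (0 < r <= n)%N -> red2 r n (x * y) = red2 r n x * red2 r n y.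
Proof.
by move=> rn; rewrite -{1}(natr_Zp x) -{1}(natr_Zp y) -natrM red2_nat// natrM.
Qed.

Lemma red2N r n x : (0 < r <= n)%N -> red2 r n (- x) = - red2 r n x.
Proof.
move=> rn; apply/eqP; rewrite -addr_eq0 -red2D// addNr.
by rewrite (red2_nat r n 0).
Qed.

Lemma red2B r n x y : (0 < r <= n)%N -> red2 r n (x - y) = red2 r n x - red2 r n y.
Proof. by move=> rn; rewrite red2D// red2N. Qed.

Lemma red2_eq0 r n (x : 'Z_(2 ^ n)) : (0 < r)%N -> (red2 r n x == 0) = (2 ^ r %| x)%N.
Proof. by move=> r0; rewrite -val_eqE /= val_Zp_nat ?exp2_gt1. Qed.

Lemma red2_eqE r n (x : 'Z_(2 ^ n)) (y : 'Z_(2 ^ r)) : (0 < r)%N ->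
  (x == y %[mod 2 ^ r])%N = (red2 r n x == y).
Proof.
by move=> r0; rewrite -(natr_Zp y) -val_eqE /= !val_Zp_nat ?exp2_gt1// modn_mod.
Qed.

Lemma zodd_red2 r n x : (0 < r <= n)%N -> zodd (red2 r n x) = zodd x.
Proof.
case/andP => r0 lern; rewrite /zodd val_Zp_nat ?exp2_gt1//.
by rewrite odd_mod// oddX orbF gtn_eqF.
Qed.

(** * Counting residues and pairs of residues *)

Lemma card_dvd_Zexp2 n i : (0 < n)%N -> (i <= n)%N ->
  #|[set x : 'Z_(2 ^ n) | (2 ^ i %| x)%N]| = (2 ^ (n - i))%N.
Proof.
move=> n0 lein.
pose f (j : 'I_(2 ^ (n - i))) : 'Z_(2 ^ n) := (2 ^ i * j)%:R.
have fE j : f j = (2 ^ i * j)%N :> nat.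
  rewrite val_Zp_nat ?exp2_gt1// modn_small//.
  by rewrite -[X in (_ < 2 ^ X)%N](subnKC lein) expnD ltn_pmul2l ?expn_gt0.
have finj : injective f.
  move=> j k /(congr1 (@nat_of_ord _)); rewrite !fE => /eqP.
  by rewrite eqn_pmul2l ?expn_gt0// => /eqP /val_inj.
rewrite -[RHS]card_ord -(card_imset _ finj); apply: eq_card => x.
rewrite inE; apply/idP/imsetP => [|[j _ ->]]; last by rewrite fE dvdn_mulr.
case/dvdnP => q xq.
have qlt : (q < 2 ^ (n - i))%N.
  rewrite -(@ltn_pmul2r (2 ^ i)) ?expn_gt0// -xq -expnD subnK//.
  exact: Zexp2_lt.
by exists (Ordinal qlt) => //; apply: val_inj; rewrite /= fE /= mulnC.
Qed.

(** The fibre is the translate, by a lift of [y], of the kernel, which consists of the multiples of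
    [2 ^ r]. *)
Lemma card_red2_fiber r n y : (0 < r <= n)%N ->
  #|[set x | red2 r n x == y]| = (2 ^ (n - r))%N.
Proof.
move=> rn; case/andP: (rn) => r0 lern; have n0 := leq_trans r0 lern.
rewrite -(@card_dvd_Zexp2 n r)//.
rewrite -[RHS](card_imset _ (addrI ((y : nat)%:R : 'Z_(2 ^ n)))); apply: eq_card => x.
have red_y : red2 r n (y : nat)%:R = y by rewrite red2_nat// natr_Zp.
rewrite inE; apply/eqP/imsetP => [xy|[z + ->]].
  exists (x - (y : nat)%:R); last by rewrite subrKC.
  by rewrite inE -red2_eq0// red2B// red_y xy subrr.
by rewrite inE -red2_eq0// red2D// red_y => /eqP ->; rewrite addr0.
Qed.

(** Induction on [n - r]. For [n - r = m + 1], the pairs whose first order is exactly [r] number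
    [2 ^ m * 2 ^ m], and the others are the pairs for [r + 1]: three times the sum is
    [3 * 4 ^ m + (4 ^ m - 1)]. For [r = n] no order exceeds the first one. *)
Lemma card_ord2_lt_pairs n r : (0 < n)%N -> (r <= n)%N ->
  (3 * #|[set p : 'Z_(2 ^ n) * 'Z_(2 ^ n) | (r <= ord2 p.1)%N && (ord2 p.1 < ord2 p.2)%N]|
   = 4 ^ (n - r) - 1)%N.
Proof.
move=> n0; move: {2}(n - r)%N (erefl (n - r)%N) => m.
elim: m r => [|m IH] r nr lern.
  have -> : r = n by lia.
  rewrite subnn eq_card0 // => -[x y]; rewrite !inE /=.
  have := ord2_leq n x n0; have := ord2_leq n y n0; lia.
have ltrn : (r < n)%N by lia.
have := IH r.+1; set Q := [set p | _]; set P := [set p | _] => /(_ _ ltrn) IH'.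
pose D i := [set x : 'Z_(2 ^ n) | (i <= ord2 x)%N].
have cD i : (i <= n)%N -> #|D i| = (2 ^ (n - i))%N.
  by move=> lein; rewrite -card_dvd_Zexp2//; apply: eq_card => x; rewrite !inE leq_ord2.
have cE : #|D r :\: D r.+1| = (2 ^ m)%N.
  rewrite cardsDS ?cD//; last by apply/fintype.subsetP => x; rewrite !inE; apply: ltnW.
  rewrite nr (_ : n - r.+1 = m)%N; last by lia.
  by rewrite expnS; lia.
have -> : P = Q :|: finset.setX (D r :\: D r.+1) (D r.+1).
  apply/setP => -[x y]; rewrite !inE /=; lia.
rewrite cardsU (_ : _ :&: _ = finset.set0); last first.
  apply/setP => -[x y]; rewrite !inE /=; lia.
rewrite cards0 subn0 cardsX cE cD// mulnDr IH'; last by lia.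
rewrite nr (_ : n - r.+1 = m)%N; last by lia.
have : (0 < 4 ^ m)%N by rewrite expn_gt0.
by rewrite -expnMn expnS -[(2 * 2)%N]/4%N; lia.
Qed.

(** * Lifts of a matrix that satisfy the order conditions *)

Lemma ord3P (P : 'I_3 -> Prop) : P 0 -> P 1 -> P 2 -> forall i, P i.
Proof.
move=> P0 P1 P2 [[|[|[|//]]] lti].
- by rewrite (_ : Ordinal lti = 0)//; apply: val_inj.
- by rewrite (_ : Ordinal lti = 1)//; apply: val_inj.
- by rewrite (_ : Ordinal lti = 2)//; apply: val_inj.
Qed.

Lemma congr_mxP r n (N : 'M['Z_(2 ^ n)]_3) (M : 'M['Z_(2 ^ r)]_3) :
  (0 < r)%N -> congr_mx N M <-> forall i j, red2 r n (N i j) = M i j.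
Proof.
move=> r0; split=> [/forallP NM i j|NM].
  by apply/eqP; rewrite -red2_eqE//; have /forallP := NM i; apply.
by apply/forallP => i; apply/forallP => j; rewrite red2_eqE// NM.
Qed.

Definition eta_set r n (M : 'M['Z_(2 ^ r)]_3) : {set 'M['Z_(2 ^ n)]_3} :=
  [set N in M30 n | [&& congr_mx N M,
                        (ord2 (minorB N) < ord2 (minorA N))%N &
                        (ord2 (minorB N) < ord2 (minorC N))%N]].

Lemma eta_setP r n (M : 'M['Z_(2 ^ r)]_3)
    (N : 'M['Z_(2 ^ n)]_3) : (0 < r)%N ->
  reflect [/\ forall i, N i 2 = 0, forall i j, red2 r n (N i j) = M i j,
              (ord2 (minorB N) < ord2 (minorA N))%N &
              (ord2 (minorB N) < ord2 (minorC N))%N]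
          (N \in eta_set r n M).
Proof.
move=> r0; rewrite !inE; apply: (iffP and4P).
  case=> /forallP N2 /(congr_mxP _ _ _ _ r0) NM BA BC; split=> // i.
  exact/eqP.
case=> N2 /(congr_mxP _ _ _ _ r0) NM BA BC; split=> //.
by apply/forallP => i; rewrite N2.
Qed.

Lemma leq_eta r n (M M' : 'M['Z_(2 ^ r)]_3)
    (f : 'M['Z_(2 ^ n)]_3 -> 'M['Z_(2 ^ n)]_3) :
  injective f ->
  (forall N, N \in eta_set r n M -> f N \in eta_set r n M') ->
  (Defs.eta M n <= Defs.eta M' n)%N.
Proof.
move=> finj fM; rewrite -[Defs.eta M n]/#|eta_set r n M| -(card_imset _ finj).
by apply/subset_leq_card/fintype.subsetP => _ /imsetP[N NM ->]; exact: fM.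
Qed.

(** * Symmetries: exchange of the two columns, and of the outer rows *)

Lemma xcol01E (S : Type) (X : 'M[S]_3) i :
  [/\ xcol 0 1 X i 0 = X i 1, xcol 0 1 X i 1 = X i 0 & xcol 0 1 X i 2 = X i 2].
Proof. by split; rewrite !mxE ?tpermL ?tpermR ?tpermD. Qed.

Lemma xrow02E (S : Type) (X : 'M[S]_3) j :
  [/\ xrow 0 2 X 0 j = X 2 j, xrow 0 2 X 1 j = X 1 j & xrow 0 2 X 2 j = X 0 j].
Proof. by split; rewrite !mxE ?tpermL ?tpermR ?tpermD. Qed.

Lemma xcolK (S : Type) (m n : nat) (i j : 'I_n) :
  involutive (@xcol S m n i j).
Proof. by move=> X; apply/matrixP => k l; rewrite !mxE tpermK. Qed.

Lemma xrowK (S : Type) (m n : nat) (i j : 'I_m) :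
  involutive (@xrow S m n i j).
Proof. by move=> X; apply/matrixP => k l; rewrite !mxE tpermK. Qed.

Lemma minors_xcol01 (S : comPzRingType) (X : 'M[S]_3) :
  [/\ minorA (xcol 0 1 X) = - minorA X, minorB (xcol 0 1 X) = - minorB X
     & minorC (xcol 0 1 X) = - minorC X].
Proof.
have [a0 a1 _] := xcol01E _ X 0; have [g0 g1 _] := xcol01E _ X 1.
have [e0 e1 _] := xcol01E _ X 2.
rewrite /minorA /minorB /minorC /entry_alpha /entry_beta /entry_gamma.
rewrite /entry_delta /entry_e /entry_f a0 a1 g0 g1 e0 e1.
by split; ring.
Qed.

Lemma minors_xrow02 (S : comPzRingType) (X : 'M[S]_3) :
  [/\ minorA (xrow 0 2 X) = - minorC X, minorB (xrow 0 2 X) = - minorB X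
     & minorC (xrow 0 2 X) = - minorA X].
Proof.
have [a0 g0 e0] := xrow02E _ X 0; have [a1 g1 e1] := xrow02E _ X 1.
rewrite /minorA /minorB /minorC /entry_alpha /entry_beta /entry_gamma.
rewrite /entry_delta /entry_e /entry_f a0 a1 g0 g1 e0 e1.
by split; ring.
Qed.

Lemma eta_xcol r n (M : 'M['Z_(2 ^ r)]_3) : (0 < r)%N -> (0 < n)%N ->
  (Defs.eta M n <= Defs.eta (xcol 0 1 M)%R n)%N.
Proof.
move=> r0 n0; apply: (@leq_eta _ _ _ _ (xcol 0 1)); first exact: inv_inj (xcolK _ _ _ _ _).
move=> N /eta_setP-/(_ r0)[N2 NM BA BC]; apply/eta_setP => //.
have [eqA eqB eqC] := minors_xcol01 _ N; rewrite eqA eqB eqC !ord2N//.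
split=> // [i|i]; have [Ni0 Ni1 Ni2] := xcol01E _ N i; first by rewrite Ni2.
by have [Mi0 Mi1 Mi2] := xcol01E _ M i; apply: ord3P; rewrite ?Ni0 ?Ni1 ?Ni2 ?Mi0 ?Mi1 ?Mi2.
Qed.

(** A and C trade places up to sign, and B changes sign, so the two order conditions are swapped. *)
Lemma eta_xrow r n (M : 'M['Z_(2 ^ r)]_3) : (0 < r)%N -> (0 < n)%N ->
  (Defs.eta M n <= Defs.eta (xrow 0 2 M)%R n)%N.
Proof.
move=> r0 n0; apply: (@leq_eta _ _ _ _ (xrow 0 2)); first exact: inv_inj (xrowK _ _ _ _ _).
move=> N /eta_setP-/(_ r0)[N2 NM BA BC]; apply/eta_setP => //.
have [eqA eqB eqC] := minors_xrow02 _ N; rewrite eqA eqB eqC !ord2N//.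
split=> // [i|i j].
  by have [Ni0 Ni1 Ni2] := xrow02E _ N 2; move: i; apply: ord3P; rewrite ?Ni0 ?Ni1 ?Ni2.
have [Ni0 Ni1 Ni2] := xrow02E _ N j; have [Mi0 Mi1 Mi2] := xrow02E _ M j.
by move: i; apply: ord3P; rewrite ?Ni0 ?Ni1 ?Ni2 ?Mi0 ?Mi1 ?Mi2.
Qed.

(** The exchange is an involution, so the inequality for [M] and for its image gives both
    directions. *)
Lemma eta_xcolE r n (M : 'M['Z_(2 ^ r)]_3) : (0 < r)%N -> (0 < n)%N ->
  Defs.eta (xcol 0 1 M)%R n = Defs.eta M n.
Proof.
move=> r0 n0; apply/eqP; rewrite eqn_leq eta_xcol// andbT.
by rewrite (leq_trans (eta_xcol _ _ _ r0 n0))// xcolK.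
Qed.

Lemma eta_xrowE r n (M : 'M['Z_(2 ^ r)]_3) : (0 < r)%N -> (0 < n)%N ->
  Defs.eta (xrow 0 2 M)%R n = Defs.eta M n.
Proof.
move=> r0 n0; apply/eqP; rewrite eqn_leq eta_xrow// andbT.
by rewrite (leq_trans (eta_xrow _ _ _ r0 n0))// xrowK.
Qed.

(** * An odd entry in the second row: no lifts *)

Lemma eta_row1_odd r n (M : 'M['Z_(2 ^ r)]_3) : (0 < r <= n)%N ->
  zodd (entry_gamma M) -> Defs.eta M n = 0%N.
Proof.
move=> rn; case/andP: (rn) => r0 lern; have n0 := leq_trans r0 lern.
move=> odd_g; apply: eq_card0 => N; apply/negP => /eta_setP-/(_ r0).
case=> _ NM BA BC.
have unit_g : N 1 0 \is a GRing.unit.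
  by rewrite -zodd_unit// -(@zodd_red2 r)// NM.
(* The order of B lies strictly below another order, hence below [n]; this lets [leq_ord2] be used
   at [ord2 (minorB N) + 1]. *)
have ltBn := leq_trans BA (ord2_leq _ _ n0).
(* First column of the row relation: gamma B = alpha A + e C, with gamma a unit. *)
have BE : minorB N = (N 1 0)^-1 * (N 0 0 * minorA N + N 2 0 * minorC N).
  apply: (mulrI unit_g); rewrite mulrA divrr// mul1r.
  rewrite /minorA /minorB /minorC /entry_alpha /entry_beta /entry_gamma.
  by rewrite /entry_delta /entry_e /entry_f; ring.
suff : (ord2 (minorB N) < ord2 (minorB N))%N by rewrite ltnn.
rewrite [X in (_ < ord2 X)%N]BE leq_ord2//.
apply: dvd_Zexp2Ml => //.
by apply: dvd_Zexp2D => //; apply: dvd_Zexp2Ml => //; rewrite -leq_ord2.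
Qed.

(** * An even second row and an odd entry elsewhere: the exact count *)

Lemma eta_alpha_odd r n (M : 'M['Z_(2 ^ r)]_3) : (0 < r <= n)%N ->
  (forall i, M i 2 = 0) ->
  minorA M = 0 -> minorB M = 0 -> minorC M = 0 ->
  ~~ zodd (entry_gamma M) -> zodd (entry_alpha M) ->
  (3 * Defs.eta M n = 64 ^ (n - r) - 16 ^ (n - r))%N.
Proof.
move=> rn M2 hA hB hC even_g odd_a.
case/andP: (rn) => r0 lern; have n0 := leq_trans r0 lern.
have unit_aM : M 0 0 \is a GRing.unit by rewrite -zodd_unit.
pose F i j := [set x | red2 r n x == M i j].
pose P := [set p : 'Z_(2 ^ n) * 'Z_(2 ^ n) |
  (r <= ord2 p.1)%N && (ord2 p.1 < ord2 p.2)%N].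
(* Parameters: lifts of alpha, beta, gamma, e, then the pair of values (B, C). *)
pose D := finset.setX (finset.setX (finset.setX (F 0 0) (F 0 1))
                                   (finset.setX (F 1 0) (F 2 0))) P.
(* With [alpha] a unit, [delta] and [f] are determined by the other entries
   and the values of [B] and [C]. *)
pose mk (p : ('Z_(2 ^ n) * 'Z_(2 ^ n)) * ('Z_(2 ^ n) * 'Z_(2 ^ n)) *
             ('Z_(2 ^ n) * 'Z_(2 ^ n))) : 'M['Z_(2 ^ n)]_3 :=
  let: ((a, b), (g, e), (B, C)) := p in
  \matrix_(i, j)
    if j == 0 then (if i == 0 then a else if i == 1 then g else e)
    else if j == 1 then (if i == 0 then b else if i == 1 then a^-1 * (b * g + C)
                         else a^-1 * (b * e + B))
    else 0.
have unit_a x : red2 r n x = M 0 0 -> x \is a GRing.unit.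
  by move=> xM; rewrite -zodd_unit// -(@zodd_red2 r)// xM zodd_unit.
have mkB a b g e B C : a \is a GRing.unit -> minorB (mk (a, b, (g, e), (B, C))) = B.
  move=> ua; rewrite /minorB /entry_alpha /entry_beta /entry_e /entry_f !mxE /=.
  by rewrite mulrA divrr// mul1r; ring.
have mkC a b g e B C : a \is a GRing.unit -> minorC (mk (a, b, (g, e), (B, C))) = C.
  move=> ua; rewrite /minorC /entry_alpha /entry_beta /entry_gamma /entry_delta !mxE /=.
  by rewrite mulrA divrr// mul1r; ring.
have mkA a b g e B C : minorA (mk (a, b, (g, e), (B, C))) = a^-1 * (g * B - e * C).
  by rewrite /minorA /entry_gamma /entry_delta /entry_e /entry_f !mxE /=; ring.
(* B and C are recovered as minors, the other four parameters as entries. *)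
have mk_inj : {in D &, injective mk}.
  move=> [[[a b] [g e]] [B C]] [[[a' b'] [g' e']] [B' C']].
  rewrite !inE /= => /andP[/andP[/andP[/eqP/unit_a ua _] _] _].
  move=> /andP[/andP[/andP[/eqP/unit_a ua' _] _] _] eq_mk.
  have <- := etrans (esym (mkB a b g e B C ua))
    (etrans (congr1 (@minorB _) eq_mk) (mkB a' b' g' e' B' C' ua')).
  have <- := etrans (esym (mkC a b g e B C ua))
    (etrans (congr1 (@minorC _) eq_mk) (mkC a' b' g' e' B' C' ua')).
  have /matrixP eqm := eq_mk.
  have := eqm 0 0; have := eqm 0 1; have := eqm 1 0; have := eqm 2 0.
  by rewrite !mxE /= => -> -> -> ->.
have -> : Defs.eta M n = #|D|.
  rewrite -(card_in_imset mk_inj); apply: eq_card => N.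
  apply/(eta_setP _ _ _ _ r0)/imsetP => [[N2 NM BA BC]|].
    have ua := unit_a _ (NM 0 0).
    exists (N 0 0, N 0 1, (N 1 0, N 2 0), (minorB N, minorC N)).
      (* [r <= ord2 (minorB N)] holds because this minor reduces to the minor B of [M], which is
         0. *)
      rewrite !inE /= !NM !eqxx /= BC andbT leq_ord2// -red2_eq0//.
      by rewrite /minorB red2B// !red2M// !NM; apply/eqP.
    apply/matrixP => i j; rewrite !mxE; move: j i; apply: ord3P; apply: ord3P => //=.
    - rewrite /minorC (_ : _ + _ = N 0 0 * N 1 1) ?mulKr//.
      by rewrite /entry_alpha /entry_beta /entry_gamma /entry_delta; ring.
    - rewrite /minorB (_ : _ + _ = N 0 0 * N 2 1) ?mulKr//.
      by rewrite /entry_alpha /entry_beta /entry_e /entry_f; ring.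
  case=> -[[[a b] [g e]] [B C]]; rewrite !inE /=.
  move=> /andP[/andP[/andP[/eqP aM /eqP bM] /andP[/eqP gM /eqP eM]] /andP[rB BC]] ->.
  have ua := unit_a _ aM.
  have ltBn := leq_trans BC (ord2_leq _ _ n0).
  have red0 x : (r <= ord2 x)%N -> red2 r n x = 0.
    by rewrite leq_ord2// -red2_eq0// => /eqP.
  (* In [M], alpha delta = beta gamma and alpha f = beta e, as C and B vanish there; dividing by the
     unit alpha shows that the computed delta and f reduce to the entries of [M]. *)
  have redK x y z : M 0 0 * z = y -> red2 r n x = y -> red2 r n (a^-1 * x) = z.
    move=> yz xy; apply: (mulrI unit_aM); rewrite yz -xy -aM -red2M//.
    by rewrite mulVKr.
  rewrite mkA mkB// mkC//; split=> //.
  - by move=> i; rewrite mxE.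
  - apply: ord3P; apply: ord3P; rewrite mxE ?M2//= ?(red2_nat r n 0)//.
      apply: (redK _ (M 0 1 * M 1 0)); first by apply/eqP; rewrite -subr_eq0; apply/eqP.
      by rewrite red2D// red2M// bM gM red0 ?addr0// (leq_trans rB)// ltnW.
    apply: (redK _ (M 0 1 * M 2 0)); first by apply/eqP; rewrite -subr_eq0; apply/eqP.
    by rewrite red2D// red2M// bM eM red0 ?addr0.
  (* In alpha A = gamma B - e C, the even gamma gains one factor 2 over B, and C has larger order
     than B by choice. *)
  - have g2 : (2 ^ 1 %| g)%N.
      rewrite expn1 dvdn2; have := even_g.
      by rewrite /entry_gamma -gM zodd_red2.
    rewrite leq_ord2//; apply: dvd_Zexp2Ml => //; apply: dvd_Zexp2D => //.
      apply: (@dvd_Zexp2M n 1) => //.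
      by rewrite -leq_ord2// ltnW.
    by rewrite dvd_Zexp2N//; apply: dvd_Zexp2Ml => //; rewrite -leq_ord2.
(* With m = n - r, four fibres of size 2^m give 16^m, to be multiplied by the 4^m - 1 of the
   pairs. *)
rewrite !cardsX !card_red2_fiber// mulnCA card_ord2_lt_pairs//.
rewrite mulnBr muln1 -!expnMn -[(2 * 2 * (2 * 2))%N]/16%N.
by rewrite -[64%N]/(16 * 4)%N expnMn.
Qed.

Lemma eta_row0_odd r n (M : 'M['Z_(2 ^ r)]_3) : (0 < r <= n)%N ->
  (forall i, M i 2 = 0) ->
  minorA M = 0 -> minorB M = 0 -> minorC M = 0 ->
  ~~ zodd (entry_gamma M) -> ~~ zodd (entry_delta M) ->
  zodd (entry_alpha M) || zodd (entry_beta M) ->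
  (3 * Defs.eta M n = 64 ^ (n - r) - 16 ^ (n - r))%N.
Proof.
move=> rn M2 hA hB hC even_g even_d; case/andP: (rn) => r0 lern.
have n0 := leq_trans r0 lern.
case/orP => [odd_a|odd_b]; first exact: eta_alpha_odd.
have [eqA eqB eqC] := minors_xcol01 _ M.
rewrite -eta_xcolE//; apply: eta_alpha_odd => //.
- by move=> i; have [_ _ ->] := xcol01E _ M i.
- by rewrite eqA hA oppr0.
- by rewrite eqB hB oppr0.
- by rewrite eqC hC oppr0.
- by rewrite /entry_gamma; have [-> _ _] := xcol01E _ M 1.
- by rewrite /entry_alpha; have [-> _ _] := xcol01E _ M 0.
Qed.

(** Exchanging the outer rows carries e, f to alpha, beta and fixes gamma, delta. *)
Lemma eta_row0_or_row2_odd r n (M : 'M['Z_(2 ^ r)]_3) : (0 < r <= n)%N ->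
  (forall i, M i 2 = 0) ->
  minorA M = 0 -> minorB M = 0 -> minorC M = 0 ->
  ~~ zodd (entry_gamma M) -> ~~ zodd (entry_delta M) ->
  [|| zodd (entry_alpha M), zodd (entry_beta M),
      zodd (entry_e M) | zodd (entry_f M)] ->
  (3 * Defs.eta M n = 64 ^ (n - r) - 16 ^ (n - r))%N.
Proof.
move=> rn M2 hA hB hC even_g even_d; case/andP: (rn) => r0 lern.
have n0 := leq_trans r0 lern.
rewrite orbA => /orP[|odd_ef]; first exact: eta_row0_odd.
have [eqA eqB eqC] := minors_xrow02 _ M.
have [a0 g0 _] := xrow02E _ M 0; have [a1 g1 _] := xrow02E _ M 1.
rewrite -eta_xrowE//; apply: eta_row0_odd => //.
- by have [? ? ?] := xrow02E _ M 2; apply: ord3P; congruence.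
- by rewrite eqA hC oppr0.
- by rewrite eqB hB oppr0.
- by rewrite eqC hA oppr0.
- by rewrite /entry_gamma g0.
- by rewrite /entry_delta g1.
- by rewrite /entry_alpha /entry_beta a0 a1.
Qed.

(** * Passage to the limit *)

(** As 8192 = 2 * 64^2, the denominator at index n + r, times 3, is 6 * 64^(r-1) * 64^n, so the term
    there is (1 - 4^(-n)) / (6 * 64^(r-1)). *)
Lemma mu_seq_cvg (R : realType) r (M : 'M['Z_(2 ^ r)]_3) : (0 < r)%N ->
  (forall n, (r <= n)%N -> (3 * Defs.eta M n = 64 ^ (n - r) - 16 ^ (n - r))%N) ->
  (mu_seq R M n @[n --> \oo] --> (1 / (6 * 64 ^+ (r - 1)) : R))%classic.
Proof.
move=> r0 etaM; rewrite -(cvg_shiftn r).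
have -> : [sequence mu_seq R M (n + r)%N]_n =
    (fun n => 1 / (6 * 64 ^+ (r - 1)) * (1 - (4^-1 : R) ^+ n)).
  apply/funext => n /=; rewrite /mu_seq.
  have := etaM (n + r)%N (leq_addl _ _); rewrite addnK => /(congr1 (fun m => m%:R : R)).
  have le_pow : (16 ^ n <= 64 ^ n)%N.
    by rewrite -[64%N]/(16 * 4)%N expnMn leq_pmulr// expn_gt0.
  rewrite natrM natrB// !natrX.
  (* The exponent may be negative; [r > 0] makes [r - 1] a true subtraction, and 64^(-2) is left to
     cancel against 8192. *)
  have -> : (64 : R) ^ ((n + r)%:Z - 3) = 64 ^+ n * 64 ^+ (r - 1) * 64 ^- 2.
    rewrite (_ : (n + r)%:Z - 3 = (n + (r - 1))%:Z - 2%:Z); last by lia.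
    by rewrite expfzDr// -exprnP exprD exprnN.
  have -> : (16 : R) ^+ n = 64 ^+ n * 4^-1 ^+ n.
    by rewrite -exprMn; congr (_ ^+ _); field.
  have : (64 : R) ^+ n != 0 by rewrite expf_neq0.
  have : (64 : R) ^+ (r - 1) != 0 by rewrite expf_neq0.
  set x := 64 ^+ n; set y := 64 ^+ (r - 1); set z := _^-1 ^+ n; set w := (Defs.eta M _)%:R.
  move=> y0 x0 h; have -> : w = x * (1 - z) / 3 by rewrite mulrBr mulr1 -h; field.
  by field; rewrite x0 y0.
set c : R := 1 / _.
suff : ((fun n => c * (1 - (4^-1 : R) ^+ n)) n @[n --> \oo] --> c * (1 - 0))%classic.
  by rewrite subr0 mulr1.
apply: cvgMr; apply: cvgB; first exact: cvg_cst.
by apply: cvg_expr; rewrite ger0_norm; lra.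
Qed.

Theorem theorem5p4 (R : realType) (k : nat) (hk : (0 < k)%N)
    (M : 'M['Z_(2 ^ k)]_3) (hM : M \in M30 k)
    (hA : minorA M = 0) (hB : minorB M = 0) (hC : minorC M = 0) :
  (zodd (entry_gamma M) || zodd (entry_delta M) ->
     cvgn (mu_seq R M) /\ mu R M = 0) /\
  (~~ zodd (entry_gamma M) -> ~~ zodd (entry_delta M) ->
   [|| zodd (entry_alpha M), zodd (entry_beta M),
       zodd (entry_e M) | zodd (entry_f M)] ->
     cvgn (mu_seq R M) /\ mu R M = 1 / (6 * 64 ^+ (k - 1))).
Proof.
have lim_mu l : (mu_seq R M n @[n --> \oo] --> l)%classic ->
    cvgn (mu_seq R M) /\ mu R M = l.
  by move=> Ml; split; [exact: cvgP Ml | exact: cvg_lim Ml].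
have M2 i : M i 2 = 0 by move: hM; rewrite inE => /forallP/(_ i)/eqP.
split=> [odd_gd|even_g even_d odd_abef].
  (* The count is known to vanish only from index [k] on, hence the shift. *)
  apply: lim_mu; rewrite -(cvg_shiftn k).
  rewrite (_ : [sequence _]_n = cst 0); first exact: cvg_cst.
  apply/funext => n /=; rewrite /mu_seq.
  have kn : (0 < k <= n + k)%N by rewrite hk leq_addl.
  have n0 : (0 < n + k)%N by rewrite addn_gt0 hk orbT.
  suff -> : Defs.eta M (n + k) = 0%N by rewrite mul0r.
  case/orP: odd_gd => [/eta_row1_odd->//|odd_d].
  (* Exchanging the columns puts the odd delta in the place of gamma. *)
  rewrite -eta_xcolE// eta_row1_odd// /entry_gamma.
  by have [-> _ _] := xcol01E _ M 1.
apply/lim_mu/mu_seq_cvg => // n len.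
by apply: eta_row0_or_row2_odd => //; rewrite hk.
Qed.
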